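(* Every $\omega$-proshift of finite type, i.e. every system in $\mathsf{DS}^{\mathsf{ef}}(\mathsf{SFT})$, has the shadowing property. In particular, the universal proshift has the shadowing property.
   Context: Deterministic systems. A deterministic system is a pair $(X,T)$ with $X$ a zero-dimensional, second-countable, compact Hausdorff (hence metrizable) space and $T:X\to X$ continuous. A factor $f:(Y,S)\to(X,T)$ is a continuous surjection with $f\circ S=T\circ f$. An embedding-factor pair (ef-pair) $(e,f):(X,T)\to(Y,S)$ consists of a factor $f:(Y,S)\to(X,T)$ together with the multifunction $e:x\mapsto f^{-1}(x)$ (the embedding uniquely determined by $f$); composition is $(e',f')\circ(e,f)=(e'\circ e,f\circ f')$. $\mathsf{detSys}^{\mathsf{ef}}$ is the category of nonempty deterministic systems with ef-pairs as morphisms (colimits of chains of ef-pairs amount to inverse limits along the factors). Shifts. For a finite alphabet $A$, $A^\omega$ has the product of discrete topologies and $\sigma(x)_n=x_{n+1}$. A shift is a closed subset $X\subseteq A^\omega$ with $\sigma[X]\subseteq X$, regarded as the system $(X,\sigma)$. It is of finite type if there is a finite set $F$ of words over $A$ such that $X$ is the set of sequences in $A^\omega$ containing no word of $F$. $\mathsf{SFT}$ is the class of (nonempty) shifts of finite type. $\mathsf{DS}^{\mathsf{ef}}(\mathsf{SFT})$ is the full subcategory of $\mathsf{detSys}^{\mathsf{ef}}$ consisting of the colimits in $\mathsf{detSys}^{\mathsf{ef}}$ of $\omega$-chains $X_0\to X_1\to\cdots$ of shifts in $\mathsf{SFT}$. The universal proshift is the up to isomorphism unique system $(U,T)$ in $\mathsf{DS}^{\mathsf{ef}}(\mathsf{SFT})$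 such that every system in $\mathsf{DS}^{\mathsf{ef}}(\mathsf{SFT})$ admits a morphism to $(U,T)$ (universality) and for every $A\in\mathsf{SFT}$ and morphisms $g,g':A\to(U,T)$ there is an automorphism $h$ of $(U,T)$ with $h\circ g'=g$ (homogeneity). Shadowing. Let $(X,T)$ be a deterministic system and $d$ a metric generating the topology of $X$ (the notion does not depend on the choice). A sequence $(x_i)_{i\in\omega}$ is a $\delta$-pseudo-orbit if $d(x_{i+1},T(x_i))<\delta$ for all $i$. A point $x$ $\varepsilon$-shadows $(x_i)$ if $d(x_i,T^i(x))<\varepsilon$ for all $i\in\omega$. $(X,T)$ has the shadowing property if for every $\varepsilon>0$ there is $\delta>0$ such that every $\delta$-pseudo-orbit is $\varepsilon$-shadowed by some point of $X$. *)

(* Defs.v *)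
From HB Require Import structures.
From mathcomp Require Import all_boot all_order all_algebra.
From mathcomp Require Import all_classical all_reals topology function_spaces.

Set Implicit Arguments.
Unset Strict Implicit.
Unset Printing Implicit Defensive.

Import Order.TTheory GRing.Theory Num.Theory.
Local Open Scope classical_set_scope.
Local Open Scope ring_scope.

(* [zero_dimensional] asks that distinct points be separated by a clopen set;
   for compact Hausdorff spaces this says that the clopen sets form a base
   (cf. [zero_dimensional_cvg]). *)
Record detSys := DetSys {
  ds_space :> topologicalType;
  ds_map : ds_space -> ds_space;
  ds_compact : compact [set: ds_space];
  ds_hausdorff : hausdorff_space ds_space;
  ds_zero_dim : zero_dimensional ds_space;
  ds_countable : @second_countable ds_space;
  ds_continuous : continuous ds_map }.

Record neDetSys := NeDetSys {
  ne_sys :> detSys;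
  ne_nonempty : [set: ne_sys] !=set0 }.

Record is_factor (Y X : detSys) (f : Y -> X) : Prop := IsFactor {
  factor_continuous : continuous f;
  factor_surj : forall x, exists y, f y = x;
  factor_equivariant : forall y, f (ds_map y) = ds_map (f y) }.

(* A morphism from X to Y; multifunctions from X to Y are maps X -> set Y. *)
Record efPair (X Y : detSys) := EfPair {
  ef_emb : X -> set Y;
  ef_fac : Y -> X;
  ef_factor : is_factor ef_fac;
  ef_embE : forall x, ef_emb x = ef_fac @^-1` [set x] }.

Lemma efPair_ext (X Y : detSys) (g h : efPair X Y) :
  ef_fac g =1 ef_fac h -> g = h.
Proof.
case: g h => [e f ff ee] [e' f' ff' ee'] /= /funext ff'E; subst f'.
have eE : e = e' by apply/funext => x; rewrite ee ee'.
by subst e'; congr EfPair; exact: Prop_irrelevance.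
Qed.

Lemma is_factor_id (X : detSys) : is_factor (fun x : X => x).
Proof. by split => // [x|x]; [exact: cvg_id | exists x]. Qed.

Definition ef_id (X : detSys) : efPair X X :=
  @EfPair X X (fun x => [set x]) (fun x => x) (is_factor_id X)
    (fun x => erefl).

Section composition.
Variables (X Y Z : detSys) (h : efPair Y Z) (g : efPair X Y).

Lemma is_factor_comp : is_factor (ef_fac g \o ef_fac h).
Proof.
have [hc hs he] := ef_factor h; have [gc gs ge] := ef_factor g; split.
- by move=> z; apply: continuous_comp; [exact: hc | exact: gc].
- move=> x; have [y <-] := gs x; have [z <-] := hs y; by exists z.
- by move=> z /=; rewrite he ge.
Qed.

Lemma ef_embE_comp x :
  \bigcup_(y in ef_emb g x) ef_emb h y =
  (ef_fac g \o ef_fac h) @^-1` [set x].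
Proof.
apply/seteqP; split => [z [y]|z /= zx].
  by rewrite !ef_embE /= => <- ->.
by exists (ef_fac h z); rewrite ?ef_embE.
Qed.

Definition ef_comp : efPair X Z :=
  @EfPair X Z (fun x => \bigcup_(y in ef_emb g x) ef_emb h y)
    (ef_fac g \o ef_fac h) is_factor_comp ef_embE_comp.

End composition.

Definition ef_iso (X Y : detSys) (h : efPair X Y) : Prop :=
  exists k : efPair Y X, ef_comp k h = ef_id X /\ ef_comp h k = ef_id Y.

Definition is_cocone (X : nat -> neDetSys)
    (g : forall n, efPair (X n) (X n.+1))
    (Y : neDetSys) (c : forall n, efPair (X n) Y) : Prop :=
  forall n, ef_comp (c n.+1) (g n) = c n.

Definition is_colimit (X : nat -> neDetSys)
    (g : forall n, efPair (X n) (X n.+1))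
    (Y : neDetSys) (c : forall n, efPair (X n) Y) : Prop :=
  is_cocone g c /\
  forall (Z : neDetSys) (d : forall n, efPair (X n) Z), is_cocone g d ->
    exists! u : efPair Y Z, forall n, ef_comp u (c n) = d n.

Definition sequences (A : finType) : topologicalType :=
  {ptws nat -> discrete_topology A}.

Definition sigma (A : finType) (x : sequences A) : sequences A :=
  fun n => x n.+1.

Record shift (A : finType) := Shift {
  shift_set :> set (sequences A);
  shift_closed : closed shift_set;
  shift_stable : @sigma A @` shift_set `<=` shift_set }.

Definition occurs (A : finType) (w : seq A) (x : sequences A) : Prop :=
  exists n, [seq x i | i <- iota n (size w)] = w.

Definition of_finite_type (A : finType) (X : shift A) : Prop :=
  exists F : seq (seq A),
    X = [set x | forall w, w \in F -> ~ occurs w x] :> set (sequences A).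

Section shift_system.
Variables (A : finType) (X : shift A).

(* [set_type X] carries the subspace topology. *)
Definition shift_space : topologicalType := set_type X.

Lemma shift_map_subproof (x : shift_space) : sigma (val x) \in (X : set _).
Proof. by apply/mem_set/shift_stable; exists (val x) => //; exact: set_valP. Qed.

Definition shift_map (x : shift_space) : shift_space :=
  exist _ (sigma (val x)) (shift_map_subproof x).

Lemma shift_val_continuous :
  continuous (val : shift_space -> sequences A).
Proof. exact: (@initial_continuous (set_type X) (sequences A) set_val). Qed.

Lemma coord_continuous n :
  continuous (fun x : sequences A => x n : discrete_topology A).
Proof. exact: (@proj_continuous _ (fun=> discrete_topology A) n). Qed.

Lemma sequences_cvg (F : set_system (sequences A)) (x : sequences A) :
  Filter F ->
  (forall n, F [set y | forall i, (i < n)%N -> y i = x i]) -> F --> x.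
Proof.
move=> FF Fx; apply/cvg_sup => i U [_ [[V oV <-] Vx] VU].
apply: filterS (Fx i.+1) => y yx; apply: VU => /=.
by rewrite (yx i).
Qed.

Lemma sigma_continuous : continuous (@sigma A).
Proof.
move=> x; apply: sequences_cvg => [|n]; first by apply: fmap_filter; exact: nbhs_filter.
have H i : nbhs x [set y : sequences A | y i = x i].
  have := @coord_continuous i x [set x i]; apply; exact: discrete_set1.
have : nbhs x (\bigcap_(i in `I_n) [set y : sequences A | y i.+1 = x i.+1]).
  elim: n => [|n ih]; first by rewrite II0 bigcap_set0; exact: filterT.
  rewrite IIS bigcap_setU bigcap_set1; apply: filterI => //; exact: H.
by apply: filterS => y yx i /= ilt; exact: yx.
Qed.

Lemma shift_map_continuous : continuous shift_map.
Proof.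
apply: (@continuous_comp_initial (set_type X) _ _ set_val shift_map).
move=> x; apply: (@continuous_comp _ _ _ (val : shift_space -> _) (@sigma A)).
  exact: shift_val_continuous.
exact: sigma_continuous.
Qed.

Lemma sequences_compact : compact [set: sequences A].
Proof.
have cA : compact [set: discrete_topology A].
  by apply: finite_compact; exact: (@finite_finset A).
have := @tychonoff nat (fun=> discrete_topology A) (fun=> setT) (fun=> cA).
by congr (compact _); rewrite eqEsubset.
Qed.

Lemma shift_compact : compact [set: shift_space].
Proof.
have cX : compact (X : set (sequences A)).
  by apply: (subclosed_compact (@shift_closed _ X) sequences_compact).
move=> F PF _.
have XF : F [set x : shift_space | shift_set X (val x)].
  by apply: filterS filterT => x _; exact: set_mem (valP x).
have [p [Xp clp]] := cX (val @ F) _ XF.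
exists (exist _ p (mem_set Xp) : shift_space); split => // P Q FP.
move=> [_ [[V oV <-] Vp] VQ].
have FvP : F [set x : shift_space | (val @` P) (val x)].
  by apply: filterS FP => x Px; exists x.
have nV : nbhs p V by apply: open_nbhs_nbhs; split => //; exact: Vp.
have [_ [[x Px <-] Vx]] := clp (val @` P) V FvP nV.
by exists x; split => //; exact: VQ.
Qed.

Lemma shift_hausdorff : hausdorff_space shift_space.
Proof.
have hs : hausdorff_space (sequences A).
  by apply: hausdorff_product => ?; exact: discrete_hausdorff.
move=> p q pq; apply/val_inj/hs => P Q nP nQ.
have [x [Px Qx]] := pq _ _ (shift_val_continuous nP) (shift_val_continuous nQ).
by exists (val x).
Qed.

Lemma shift_zero_dim : zero_dimensional shift_space.
Proof.
have zd : zero_dimensional (sequences A).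
  by apply: zero_dimension_prod => _; exact: discrete_zero_dimension.
move=> x y xy; have [|U [cU Ux Uy]] := zd (val x) (val y).
  by rewrite (inj_eq val_inj).
exists (val @^-1` U); split => //.
by apply: preimage_clopen => //; exact: shift_val_continuous.
Qed.

Lemma shift_countable : @second_countable shift_space.
Proof.
pose cyl (w : seq A) : set shift_space :=
  [set x | [seq val x i | i <- iota 0 (size w)] = w].
have nb (x : shift_space) n :
    nbhs x [set y : shift_space | forall i, (i < n)%N -> val y i = val x i].
  have : nbhs x (\bigcap_(i in `I_n)
      [set y : shift_space | val y i = val x i]).
    elim: n => [|n ih]; first by rewrite II0 bigcap_set0; exact: filterT.
    rewrite IIS bigcap_setU bigcap_set1; apply: filterI => //.
    have : nbhs (val x) [set y : sequences A | y n = val x n].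
      have := @coord_continuous n (val x) [set val x n]; apply.
      exact: discrete_set1.
    by move/shift_val_continuous.
  by apply: filterS => y yx i; exact: yx.
exists (range cyl).
  by apply: card_le_trans (card_image_le _ _) _; exact: countableP.
split=> [_ [w _ <-]|x].
  rewrite openE => x; rewrite /cyl /= => xw.
  apply: filterS (nb x (size w)) => y /= yx; rewrite -[RHS]xw.
  by apply/eq_in_map => i; rewrite mem_iota add0n => /andP[_]; exact: yx.
move=> U [_ [[V oV <-] Vx] VU].
have : nbhs (val x) V by exact: open_nbhs_nbhs.
pose G := filter_from [set: nat]
  (fun n => [set y : sequences A | forall i, (i < n)%N -> y i = val x i]).
have FG : Filter G.
  apply: filter_from_filter; first by exists 0%N.
  move=> m n _ _; exists (maxn m n) => // y /= yx.
  by split=> i il; apply: yx; rewrite leq_max il ?orbT.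
have /[apply] : G --> val x by apply: sequences_cvg => n; exists n.
case=> n _ nV; exists (cyl [seq val x i | i <- iota 0 n]).
  by split; [exists [seq val x i | i <- iota 0 n] |
             rewrite /cyl /= size_map size_iota].
move=> y; rewrite /cyl /= size_map size_iota => yx; apply/VU/nV => i il /=.
by move/eq_in_map: yx; apply; rewrite mem_iota.
Qed.

Definition shift_sys : detSys :=
  DetSys shift_compact shift_hausdorff shift_zero_dim shift_countable
    shift_map_continuous.

End shift_system.

Record sft := Sft {
  sft_alphabet : finType;
  sft_shift : shift sft_alphabet;
  sft_finite : of_finite_type sft_shift;
  sft_nonempty : (sft_shift : set _) !=set0 }.

Lemma sft_sys_nonempty (X : sft) : [set: shift_sys (sft_shift X)] !=set0.
Proof.
by have [x Xx] := sft_nonempty X; exists (exist _ x (mem_set Xx)).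
Qed.

Definition sft_sys (X : sft) : neDetSys := NeDetSys (@sft_sys_nonempty X).

(* Membership in the full subcategory, whose morphisms are all ef-pairs. *)
Definition is_proshift_ft (Y : neDetSys) : Prop :=
  exists (X : nat -> sft)
    (g : forall n, efPair (sft_sys (X n)) (sft_sys (X n.+1)))
    (c : forall n, efPair (sft_sys (X n)) Y),
    is_colimit (X := fun n => sft_sys (X n)) g c.

Record is_universal_proshift (U : neDetSys) : Prop := IsUniversalProshift {
  universal_proshift_ft : is_proshift_ft U;
  universal_universality :
    forall Y : neDetSys, is_proshift_ft Y -> inhabited (efPair Y U);
  universal_homogeneity :
    forall (A : sft) (g g' : efPair (sft_sys A) U),
      exists2 h : efPair U U, ef_iso h & ef_comp h g' = g }.

Record is_metric (R : realType) (X : Type) (d : X -> X -> R) : Prop :=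
  IsMetric {
    metric_ge0 : forall x y, 0 <= d x y;
    metric_eq0 : forall x y, d x y = 0 <-> x = y;
    metric_symm : forall x y, d x y = d y x;
    metric_tri : forall x y z, d x z <= d x y + d y z }.

Definition generates_topology (R : realType) (X : topologicalType)
    (d : X -> X -> R) : Prop :=
  forall (x : X) (V : set X),
    nbhs x V <-> exists2 e, 0 < e & [set y | d x y < e] `<=` V.

Section shadowing.
Variables (R : realType) (X : detSys) (d : X -> X -> R).

Definition pseudo_orbit (delta : R) (x : nat -> X) : Prop :=
  forall i, d (x i.+1) (ds_map (x i)) < delta.

Definition shadows (eps : R) (y : X) (x : nat -> X) : Prop :=
  forall i, d (x i) (iter i (@ds_map X) y) < eps.

Definition shadowing_for : Prop :=
  forall eps, 0 < eps -> exists2 delta, 0 < delta &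
    forall x, pseudo_orbit delta x -> exists y, shadows eps y x.

End shadowing.

(* The choice of metric is immaterial, so the property is required of every
   compatible metric; compatible metrics exist by Urysohn's theorem. *)
Definition has_shadowing (R : realType) (X : detSys) : Prop :=
  forall d : X -> X -> R,
    is_metric d -> generates_topology d -> shadowing_for d.

(* Main.v *)
Require Import Defs.
From mathcomp Require Import all_boot all_order all_algebra.
From mathcomp Require Import all_classical all_reals topology function_spaces.
From mathcomp Require Import lra.

(** A pseudo-orbit in the limit of a chain of shifts of finite type is pushed
    down to one level [X_n] of the chain, where it becomes a sequence of points
    [a_i] such that [sigma a_i] and [a_{i+1}] agree on a window longer than all
    forbidden words.  Reading off the first letters of the [a_i] gives a point
    of [X_n] whose orbit stays close to [a_i], and a preimage of it shadows the
    pseudo-orbit.  Compactness makes closeness at a single level, on finitely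
    many coordinates, sufficient; it needs that the colimit maps separate
    points, which follows by applying the universal property to the image of
    the colimit in the product of the [X_n]. *)

Set Implicit Arguments.
Unset Strict Implicit.
Unset Printing Implicit Defensive.

Import numFieldTopology.Exports.
Import Order.TTheory GRing.Theory Num.Theory.
Local Open Scope classical_set_scope.
Local Open Scope ring_scope.

(** * The image of a cocone's vertex in the product of the chain *)

Section threads.
Variables (X : nat -> neDetSys) (g : forall n, efPair (X n) (X n.+1)).
Variables (Y : neDetSys) (c : forall n, efPair (X n) Y).
Hypothesis cg : is_cocone g c.

Definition thread (y : Y) : prod_topology (fun n => ds_space (X n)) :=
  fun n => ef_fac (c n) y.

(** Taking the image of [Y] rather than all compatible sequences lets compactness, and surjectivity
    of the projections, be inherited from [Y] and the [c n]. *)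
Definition threads : topologicalType := set_type (range thread).

Definition thread_proj n (z : threads) : X n := val z n.

Definition to_threads (y : Y) : threads :=
  exist _ (thread y) (mem_set (imageT thread y)).

Lemma thread_proj_to_threads n y :
  thread_proj n (to_threads y) = ef_fac (c n) y.
Proof. by []. Qed.

Lemma to_threads_surj z : exists y, to_threads y = z.
Proof.
have [y _ yz] := set_mem (valP z).
by exists y; apply: val_inj.
Qed.

Lemma thread_proj_inj z z' :
  (forall n, thread_proj n z = thread_proj n z') -> z = z'.
Proof. by move=> zz'; apply/val_inj/functional_extensionality_dep. Qed.

Lemma thread_proj_continuous n : continuous (thread_proj n).
Proof.
move=> z; apply: (@continuous_comp _ _ _ (val : threads -> prod_topology _)
  (fun f : prod_topology (fun n => ds_space (X n)) => f n)).
  exact: (@initial_continuous (set_type (range thread)) _ set_val).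
exact: (@proj_continuous _ (fun n => ds_space (X n)) n).
Qed.

Lemma threads_cvg (F : set_system threads) (z : threads) : Filter F ->
  (forall n, thread_proj n @ F --> thread_proj n z) -> F --> z.
Proof.
move=> FF Fz U [_ [[V oV <-] Vz] VU].
have : val @ F --> (val z : prod_topology (fun n => ds_space (X n))).
  apply/cvg_sup => n W [_ [[B oB <-] Bz] BW].
  apply: filterS BW _; apply: (Fz n); exact: open_nbhs_nbhs.
move=> /(_ V) FV; apply: filterS VU _; apply: FV.
exact: open_nbhs_nbhs.
Qed.

Lemma to_threads_continuous : continuous to_threads.
Proof.
move=> y; apply: threads_cvg => n A nA.
exact: (factor_continuous (ef_factor (c n)) nA).
Qed.

Lemma threads_compact : compact [set: threads].
Proof.
have <- : to_threads @` setT = [set: threads].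
  rewrite -subTset => z _; have [y <-] := to_threads_surj z; exact: imageT.
apply: continuous_compact; last exact: ds_compact.
exact/continuous_subspaceT/to_threads_continuous.
Qed.

Lemma threads_hausdorff : hausdorff_space threads.
Proof.
move=> p q pq; apply: thread_proj_inj => n.
apply: ds_hausdorff => P Q nP nQ.
have [z [Pz Qz]] :=
  pq _ _ (@thread_proj_continuous n p _ nP) (@thread_proj_continuous n q _ nQ).
by exists (thread_proj n z).
Qed.

Lemma threads_zero_dim : zero_dimensional threads.
Proof.
move=> p q /eqP pq.
have [n /eqP npq] : exists n, thread_proj n p <> thread_proj n q.
  by apply/existsNP => /thread_proj_inj.
have [U [cU Up Uq]] := ds_zero_dim npq.
exists (thread_proj n @^-1` U); split => //.
by apply: preimage_clopen => //; exact: thread_proj_continuous.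
Qed.

Lemma thread_projS n z : ef_fac (g n) (thread_proj n.+1 z) = thread_proj n z.
Proof.
have [y <-] := to_threads_surj z; rewrite !thread_proj_to_threads.
exact: (congr1 (fun h => ef_fac h y) (cg n)).
Qed.

(* Along the chain the preimages of neighbourhoods grow with the level, so a
   single level suffices to describe a neighbourhood in the product. *)
Lemma threads_nbhs (z : threads) (V : set threads) : nbhs z V ->
  exists n, exists2 W, nbhs (thread_proj n z) W & thread_proj n @^-1` W `<=` V.
Proof.
(* The claim says that [G] converges to [z]. Once [G] is a filter this can be tested one coordinate
   at a time, where it is immediate. *)
pose G : set_system threads := [set V | exists n,
  exists2 W, nbhs (thread_proj n z) W & thread_proj n @^-1` W `<=` V].
have up n W k : nbhs (thread_proj n z) W -> exists2 W',
    nbhs (thread_proj (k + n) z) W' &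
    thread_proj (k + n) @^-1` W' `<=` thread_proj n @^-1` W.
  elim: k => [|k ih] nW; first by exists W.
  have [W' nW' WW'] := ih nW.
  exists (ef_fac (g (k + n)) @^-1` W').
    apply: (factor_continuous (ef_factor (g (k + n)))).
    by rewrite thread_projS.
  by move=> x Wx; apply: WW'; rewrite /= -thread_projS.
have GF : Filter G.
  split.
  - by exists 0, setT; [exact: filterT|].
  - move=> A B [m [P nP PA]] [n [Q nQ QB]].
    have [P' nP' PP'] := up _ _ n nP; have [Q' nQ' QQ'] := up _ _ m nQ.
    rewrite addnC in P' nP' PP'.
    exists (m + n)%N, (P' `&` Q'); first exact: filterI.
    by move=> x [/PP'/PA ? /QQ'/QB].
  - by move=> A B AB [n [W nW WA]]; exists n, W => //; exact: subset_trans AB.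
suff : G --> z by apply.
by apply: threads_cvg => n W nW; exists n, W.
Qed.

Lemma threads_countable : @second_countable threads.
Proof.
pose base n := sval (cid2 (ds_countable (X n))).
have base_count n : countable (base n) by rewrite /base; case: cid2.
have baseP n : basis (base n) by rewrite /base; case: cid2.
exists (\bigcup_n [set thread_proj n @^-1` U | U in base n]).
  apply: bigcup_countable => // n _.
  by apply: card_le_trans (card_image_le _ _) _; exact: base_count.
split=> [_ [n _ [U bU <-]]|z V /threads_nbhs[n [W nW WV]]].
  apply: open_comp; last exact: (baseP n).1.
  by move=> x _; exact: thread_proj_continuous.
have [U [bU Uz] UW] := (baseP n).2 _ _ nW.
exists (thread_proj n @^-1` U); first by split=> //; exists n => //; exists U.
by apply: subset_trans WV => x /UW.
Qed.

Lemma threads_map_subproof (z : threads) :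
  (fun n => ds_map (thread_proj n z)) \in range thread.
Proof.
apply/mem_set; have [y <-] := to_threads_surj z.
exists (ds_map y) => //; apply/functional_extensionality_dep => n.
exact: (factor_equivariant (ef_factor (c n))).
Qed.

Definition threads_map (z : threads) : threads :=
  exist _ (fun n => ds_map (thread_proj n z)) (threads_map_subproof z).

Lemma threads_map_continuous : continuous threads_map.
Proof.
move=> z; apply: threads_cvg => [|n A nA].
  by apply: fmap_filter; exact: nbhs_filter.
exact: (thread_proj_continuous (ds_continuous nA)).
Qed.

Definition threads_sys : neDetSys :=
  @NeDetSys (DetSys threads_compact threads_hausdorff threads_zero_dim
    threads_countable threads_map_continuous)
    (let: ex_intro y _ := ne_nonempty Y in ex_intro _ (to_threads y) I).

Lemma is_factor_thread_proj n :
  is_factor (thread_proj n : threads_sys -> X n).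
Proof.
split=> // [|x]; first exact: thread_proj_continuous.
by have [y <-] := factor_surj (ef_factor (c n)) x; exists (to_threads y).
Qed.

Definition thread_ef n : efPair (X n) threads_sys :=
  EfPair (is_factor_thread_proj n) (fun=> erefl).

Lemma is_cocone_thread_ef : is_cocone g thread_ef.
Proof. by move=> n; apply: efPair_ext => z; exact: thread_projS. Qed.

End threads.

(* The universal property yields a factor from the system of threads onto [Y]
   through which every point of [Y] is determined by its thread. *)
Lemma colimit_separates (X : nat -> neDetSys)
    (g : forall n, efPair (X n) (X n.+1)) (Y : neDetSys)
    (c : forall n, efPair (X n) Y) :
  is_colimit g c ->
  forall y y', (forall n, ef_fac (c n) y = ef_fac (c n) y') -> y = y'.
Proof.
move=> [cg univ] y y' yy'.
have [u [cu _]] := univ _ _ (is_cocone_thread_ef cg).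
have uE n z : ef_fac (c n) (ef_fac u z) = thread_proj n z.
  exact: (congr1 (fun h => ef_fac h z) (cu n)).
have us := factor_surj (ef_factor u).
have [[z zy] [z' zy']] := (us y, us y').
rewrite -zy -zy'; congr (ef_fac u _); apply: thread_proj_inj => n.
by rewrite -!uE zy zy'.
Qed.

(** * Compactness of nested closed sets, and compatible metrics *)

(** A point outside [W] misses some closed [E n], so a neighbourhood of it misses all later [E m];
    near-covering compactness then makes the index uniform. Applied to relations on [Y * Y], this
    supplies the level, the window and the radius in the shadowing argument. *)
Lemma compact_nested_subset (T : topologicalType) (E : nat -> set T)
    (W : set T) :
  compact [set: T] -> (forall n, closed (E n)) ->
  (forall m n, (m <= n)%N -> E n `<=` E m) -> open W ->
  \bigcap_n E n `<=` W -> exists n, E n `<=` W.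
Proof.
move=> /compact_near_coveringP cT cE Emono oW EW.
have [] := cT nat \oo (fun n x => E n x -> W x) _.
  move=> x _; have [Wx|nWx] := pselect (W x).
    have : nbhs x W by exact: open_nbhs_nbhs.
    by move=> nW; exists (W, setT); [split=> //; exact: filterT|move=> [y n] []].
  have [n nEx] : exists n, ~ E n x by apply/existsNP => Ex; apply/nWx/EW.
  exists (~` E n, [set m | (n <= m)%N]); last first.
    by move=> [y m] /= [nEy /Emono nm /nm].
  split; last by exists n.
  by apply: open_nbhs_nbhs; split=> //; exact: closed_openC.
by move=> n _ nE; exists n => x; exact: nE n (leqnn n) x I.
Qed.

Section metric.
Variables (R : realType) (T : topologicalType) (d : T -> T -> R).
Hypotheses (dm : is_metric d) (dt : generates_topology d).

Lemma metric_continuous : continuous (fun p : T * T => d p.1 p.2).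
Proof.
move=> [x y]; apply/cvg_ballP => e e0 /=.
have nb z : nbhs z [set u | d z u < e / 2].
  by apply/dt; exists (e / 2) => //; rewrite divr_gt0.
exists ([set u | d x u < e / 2], [set v | d y v < e / 2]); first by split; exact: nb.
move=> [u v] [/= du dv]; rewrite /ball /= ltr_norml.
have [t1 t2] := (metric_tri dm x u y, metric_tri dm u v y).
have [t3 t4] := (metric_tri dm u x v, metric_tri dm x y v).
rewrite (metric_symm dm v y) in t2; rewrite (metric_symm dm u x) in t3.
apply/andP; split; lra.
Qed.

Lemma open_metric_lt e : open [set p : T * T | d p.1 p.2 < e].
Proof.
apply: (@open_comp _ _ _ [set r : R | r < e]); last by rewrite -set_itvNyo; exact: lray_open.
by move=> p _; exact: metric_continuous.
Qed.

Lemma closed_metric_le e : closed [set p : T * T | d p.1 p.2 <= e].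
Proof.
apply: (@preimage_closed _ _ _ [set r : R | r <= e]); last by rewrite -set_itvNyc; exact: lray_closed.
by move=> p _; exact: metric_continuous.
Qed.

End metric.

(** * Agreement on initial windows and tracing in shifts of finite type *)

Lemma shift_coord_continuous (A : finType) (X : shift A) i :
  continuous (fun x : shift_space X => val x i : discrete_topology A).
Proof.
move=> x; apply: (@continuous_comp _ _ _ (val : shift_space X -> sequences A)
  (fun s : sequences A => s i : discrete_topology A)).
  exact: shift_val_continuous.
exact: coord_continuous.
Qed.

(** A relation on [Y] rather than on the shift, so that it can be compared with metric entourages
    inside the compact space [Y * Y]. *)
Definition agree (A : finType) (X : shift A) (Y : Type) (f : Y -> shift_space X)
    (k : nat) : set (Y * Y) :=
  [set p | forall i, (i < k)%N -> val (f p.1) i = val (f p.2) i].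

Lemma locally_constant_clopen (T : topologicalType) (D : discreteTopologicalType)
    (phi : T -> D) (P : D -> D -> Prop) :
  continuous phi -> clopen [set p : T * T | P (phi p.1) (phi p.2)].
Proof.
move=> cphi.
have op (Q : D -> D -> Prop) : open [set p : T * T | Q (phi p.1) (phi p.2)].
  rewrite openE => -[x y] /= Qxy.
  exists (phi @^-1` [set phi x], phi @^-1` [set phi y]).
    by split; apply: cphi; exact: discrete_set1.
  by move=> [u v] [/= -> ->].
by split=> //; rewrite -openC; exact: (op (fun a b => ~ P a b)).
Qed.

Lemma agree_clopen (A : finType) (X : shift A) (Y : topologicalType)
    (f : Y -> shift_space X) k : continuous f -> clopen (agree f k).
Proof.
move=> cf.
have -> : agree f k = \bigcap_(i in `I_k)
   [set p | val (f p.1) i = val (f p.2) i] by [].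
elim: k => [|k ih]; first by rewrite II0 bigcap_set0; exact: clopenT.
rewrite IIS bigcap_setU bigcap_set1; apply: clopenI => //.
apply: (@locally_constant_clopen Y (discrete_topology A)
  (fun y => val (f y) k) (fun a b => a = b)).
move=> y; apply: (@continuous_comp _ _ _ f
  (fun x : shift_space X => val x k : discrete_topology A)); first exact: cf.
exact: shift_coord_continuous.
Qed.

(** The sequence of first letters of the [a i] carries, from position [i] on, the first [M + 1]
    letters of [a i]. A forbidden word has at most [M] letters, so an occurrence at [i] would
    already be one at the start of [a i]. *)
Lemma sft_trace (A : finType) (X : shift A) (F : seq (seq A)) (M : nat)
    (a : nat -> shift_space X) :
  X = [set x | forall w, w \in F -> ~ occurs w x] :> set (sequences A) ->
  (forall w, w \in F -> (size w <= M)%N) ->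
  (forall i j, (j < M)%N -> val (a i) j.+1 = val (a i.+1) j) ->
  exists z : shift_space X, forall i j, (j <= M)%N ->
    val (iter i (@shift_map _ X) z) j = val (a i) j.
Proof.
move=> XF FM aM.
have aF i w : w \in F -> ~ occurs w (val (a i)).
  by have := set_mem (valP (a i)); move: (val (a i)) => s; rewrite XF; exact.
pose z : sequences A := fun i => val (a i) 0.
(* Induction on [j]: one position is traded for one step along the sequence, as letter [j + 1] of
   [a i] is letter [j] of its successor. *)
have za i j : (j <= M)%N -> z (i + j)%N = val (a i) j.
  elim: j i => [|j ih] i jM; first by rewrite addn0.
  by rewrite addnS -addSn ih ?aM // ltnW.
have Xz : (X : set _) z.
  rewrite XF => w wF [i zw].
  apply: (aF i w wF); exists 0%N; rewrite -[RHS]zw -[in RHS](addn0 i) iotaDl -map_comp.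
  apply/eq_in_map => j; rewrite mem_iota add0n => /andP[_ jw] /=.
  by rewrite za // (leq_trans (ltnW jw)) // FM.
exists (exist _ z (mem_set Xz)) => i j jM; rewrite -za //.
by elim: i j {jM} => [|i ih] j //=; rewrite /sigma ih addnS.
Qed.

Lemma eq_image_bigcap_agree (A : finType) (X : shift A) (Y : Type)
    (f : Y -> shift_space X) :
  [set p | f p.1 = f p.2] = \bigcap_k agree f k.
Proof.
apply/seteqP; split=> [p /= fp k _ i _|p fp]; first by rewrite fp.
by apply/val_inj/funext => i; exact: fp i.+1 I i (ltnSn i).
Qed.

(** * Shadowing for proshifts of finite type *)

Lemma proshift_ft_shadowing (R : realType) (Y : neDetSys) :
  is_proshift_ft Y -> has_shadowing R Y.
Proof.
move=> [X [g [c colim]]] d dm dt eps eps0.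
have cc n : continuous (ef_fac (c n)) := factor_continuous (ef_factor (c n)).
have YY : compact [set: Y * Y].
  by rewrite -setXTT; apply: compact_setX; exact: ds_compact.
pose level n := [set p : Y * Y | ef_fac (c n) p.1 = ef_fac (c n) p.2].
(* The kernels of the colimit maps decrease by the cocone identity and meet in the diagonal because
   these maps separate points. *)
have [n nd] : exists n, level n `<=` [set p | d p.1 p.2 < eps].
  apply: compact_nested_subset => //; last 2 first.
  - exact: open_metric_lt.
  - move=> [y y'] /= yy'.
    have -> : y = y' by apply: (colimit_separates colim) => n; exact: yy' n I.
    by rewrite (metric_eq0 dm y' y').2.
  - move=> n; rewrite /level eq_image_bigcap_agree; apply: closed_bigI => k _.
    exact: (agree_clopen k (cc n)).2.
  - move=> m n mn p; elim: n mn => [|n ih]; first by rewrite leqn0 => /eqP ->.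
    rewrite leq_eqVlt => /predU1P[-> //|mn] pn; apply: ih => //.
    by rewrite /level /= -(colim.1 n) /= pn.
(* The kernel at level [n] is itself the intersection of the window relations, so a finite window
   suffices. *)
have [k kd] : exists k, agree (ef_fac (c n)) k `<=` [set p | d p.1 p.2 < eps].
  apply: compact_nested_subset => //; last 2 first.
  - exact: open_metric_lt.
  - by rewrite -eq_image_bigcap_agree.
  - by move=> k; exact: (agree_clopen k (cc n)).2.
  - by move=> k l kl p pl i ik; apply: pl; exact: leq_trans kl.
have [F XF] := sft_finite (X n).
(* The bound [k] ensures closeness within [eps]; the longest forbidden word ensures that tracing
   stays in [X n]. *)
pose M := maxn k (\max_(w <- F) size w).
(* Conversely, the closed metric entourages shrink to the diagonal, which lies in the open relation
   [agree]; this yields [delta]. *)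
have [j jM] : exists j, [set p | d p.1 p.2 <= j.+1%:R^-1] `<=`
    agree (ef_fac (c n)) M.
  pose E j := [set p : Y * Y | d p.1 p.2 <= j.+1%:R^-1].
  apply: (compact_nested_subset (E := E)) => //.
  - by move=> j; exact: closed_metric_le.
  - move=> i j ij p /= /le_trans; apply.
    by rewrite lef_pV2 ?posrE ?ltr0n // ler_nat ltnS.
  - exact: (agree_clopen M (cc n)).1.
  - move=> [y y'] /= yy'; suff -> : y = y' by [].
    apply/(metric_eq0 dm)/eqP; rewrite eq_le (metric_ge0 dm) andbT.
    apply/ler_addgt0Pl => e e0; rewrite addr0.
    have [j je] := ltr_add_invr e0.
    by rewrite add0r in je; apply: le_trans (yy' j I) (ltW je).
exists j.+1%:R^-1; first by rewrite invr_gt0 ltr0n.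
move=> x px.
have [||z zx] := sft_trace (a := fun i => ef_fac (c n) (x i)) (M := M) XF.
- by move=> w wF; rewrite leq_max (leq_bigmax_seq _ wF) ?orbT.
(* The entourage is applied to the pair formed by the next point and the image of the current one;
   equivariance turns that image into a shift. *)
- move=> i l lM; have /= -> // := jM (x i.+1, ds_map (x i)) (ltW (px i)) l.
  by rewrite (factor_equivariant (ef_factor (c n))).
(* Any preimage works, since [kd] tests closeness only through level [n]. *)
have [y yz] := factor_surj (ef_factor (c n)) z.
exists y => i; apply: (kd (x i, iter i (@ds_map Y) y)) => l lk /=.
have -> : ef_fac (c n) (iter i (@ds_map Y) y) = iter i (@shift_map _ _) z.
  rewrite -yz; elim: i => //= i ih.
  by rewrite (factor_equivariant (ef_factor (c n))) ih.
by rewrite zx // ltnW // (leq_trans lk) // leq_maxl.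
Qed.

Theorem corollary10p8 (R : realType) :
  (forall X : neDetSys, is_proshift_ft X -> has_shadowing R X) /\
  (forall U : neDetSys, is_universal_proshift U -> has_shadowing R U).
Proof.
split=> [X|U uU]; apply: proshift_ft_shadowing => //.
exact: universal_proshift_ft uU.
Qed.
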